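(* Let $b\geqslant 2$ be an integer. Then $\mu(\mathcal{G}(1/b))=\mu(\mathcal{F}(1/b))=2$. In particular, $$\mu\left(\sum_{n\geqslant 0}\frac{1}{2^{2^n}+1}\right)=2.$$
   Context: Define the power series (convergent for $|z|<1$) $$\mathcal{F}(z):=\sum_{n=0}^\infty\frac{z^{2^n}}{1+z^{2^n}}\qquad\text{and}\qquad \mathcal{G}(z):=\sum_{n=0}^\infty\frac{z^{2^n}}{1-z^{2^n}}.$$ For a real number $\alpha$, the irrationality exponent $\mu(\alpha)$ is the supremum of the set of real numbers $\mu$ such that the inequality $|\alpha-p/q|<q^{-\mu}$ has infinitely many solutions $(p,q)\in\mathbb{Z}\times\mathbb{N}$. *)

(* Defs.v *)
From HB Require Import structures.
From mathcomp Require Import all_boot all_order all_algebra.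
From mathcomp Require Import all_classical all_reals all_analysis.

Set Implicit Arguments.
Unset Strict Implicit.
Unset Printing Implicit Defensive.

Import Order.TTheory GRing.Theory Num.Theory.
Import numFieldNormedType.Exports.

Local Open Scope classical_set_scope.
Local Open Scope ring_scope.

(* Meant for |z| < 1, where the two series converge (the limit of a divergent
   sequence is an unspecified default value). *)
Definition calF (R : realType) (z : R) : R :=
  limn (series (fun n => z ^+ (2 ^ n) / (1 + z ^+ (2 ^ n)))).

Definition calG (R : realType) (z : R) : R :=
  limn (series (fun n => z ^+ (2 ^ n) / (1 - z ^+ (2 ^ n)))).

(* Denominators are positive, and pairs (p, q) are not required to be reduced.
   The supremum is taken in the extended reals, as it may be infinite. *)
Definition irrationality_exponent (R : realType) (alpha : R) : \bar R :=
  ereal_sup [set mu%:E | mu in [set mu : R |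
    infinite_set [set pq : int * nat | (0 < pq.2)%N /\
      `|alpha - pq.1%:~R / pq.2%:R| < pq.2%:R `^ (- mu)]]].

(* Main.v *)
(* Let e = 1 for G and e = -1 for F. Reduced mod 2, both series satisfy the
   quadratic equation T^2 + T = x / (1 + x) over F_2(x), so, as in
   Liouville's theorem, Q T - P vanishes to order at most 2n + 1 at 0 for
   P, Q over F_2 of degree at most n, Q != 0. Linear algebra over the rationals
   gives a primitive integral Q of degree at most n and an integral P such that
   Q T - P = h x^(2n+1) + O(x^(2n+2)); by the mod 2 bound h is odd, hence
   nonzero. Put X = b^(2^m). The functional equation writes the value at 1/b as
   the value at 1/X plus a rational with denominator dividing X - 1, so
   evaluating at 1/X gives integers p, q with |q| = O(X^(n+1)) and
   |q alpha - p| of exact order X^(-n). Letting n grow, these show that the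
   exponent is at least 2. For the upper bound, the powers X^n with N <= n <= 2N
   and m arbitrary have gaps of ratio at most 1 + 1/N in the exponent, so every
   rational p'/q' can be compared with a p/q for which X^n is close to q'. *)

Require Import Defs.
From HB Require Import structures.
From mathcomp Require Import all_boot all_order all_algebra.
From mathcomp Require Import all_classical all_reals all_analysis.
From mathcomp Require Import ring lra.
From mathcomp Require Import zify.

Set Implicit Arguments.
Unset Strict Implicit.
Unset Printing Implicit Defensive.

Import Order.TTheory GRing.Theory Num.Theory.
Import numFieldNormedType.Exports.

Local Open Scope classical_set_scope.
Local Open Scope ring_scope.

(** * Rational approximation over the field with two elements *)

(** Equality would force [2 deg Q = deg P + deg (Q - P)]. The right side is too small if
    [deg P < deg Q] and too large if [deg P > deg Q]; if the degrees agree, both leading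
    coefficients are 1 and cancel in [Q - P]. The difference of the two sides is [1 - 'X] times the
    norm of [Q T - P] when [T - T^2 = 'X / (1 - 'X)]. *)
Lemma polyF2_norm_neq (F : fieldType) (F2 : forall c : F, c != 0 -> c = 1)
    (P Q : {poly F}) : Q != 0 ->
  'X * Q ^+ 2 != (1 - 'X) * P * (Q - P).
Proof.
move=> Q0; apply/eqP => E.
have sX : size (1 - 'X : {poly F}) = 2%N.
  by rewrite -opprB size_polyN size_XsubC.
have E0 : 'X * Q ^+ 2 != 0 by rewrite mulf_neq0 ?polyX_eq0 ?expf_neq0.
have P0 : P != 0 by apply: contraNneq E0 => P0; rewrite E P0 mulr0 mul0r.
have D0 : Q - P != 0 by apply: contraNneq E0 => D0; rewrite E D0 mulr0.
have sE : (size Q + size Q = size P + size (Q - P)%R)%N.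
  have szM (p q : {poly F}) : p != 0 -> q != 0 ->
      (size (p * q)%R).+1 = (size p + size q)%N.
    move=> p0 q0; rewrite size_mul //.
    by move: p0; rewrite -size_poly_gt0; case: (size p).
  have X0 : 'X != 0 :> {poly F} by rewrite polyX_eq0.
  have sX0 : size ('X : {poly F}) = 2%N by rewrite size_polyX.
  have X1 : 1 - 'X != 0 :> {poly F} by rewrite -size_poly_gt0 sX.
  have := szM _ _ X0 (mulf_neq0 Q0 Q0); have := szM _ _ Q0 Q0.
  have := szM _ _ (mulf_neq0 X1 P0) D0; have := szM _ _ X1 P0.
  rewrite -E sX sX0 expr2; set u := size _; set v := size _; set w := size _.
  set z := size (Q - P); move: (size (Q * Q)) (size Q) @u @v @w @z => *; lia.
have [lt|lt|eqs] := ltngtP (size P) (size Q).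
- by move: sE; rewrite size_polyDl ?size_polyN // => sE; lia.
- have sD : size (Q - P) = size P.
    by rewrite addrC size_polyDl size_polyN.
  by rewrite sD in sE; lia.
have lead (p : {poly F}) : p != 0 -> lead_coef p = 1.
  by rewrite -lead_coef_eq0 => /F2.
suff : (size (Q - P)%R < size Q)%N by lia.
rewrite (leq_ltn_trans _ (_ : (size Q).-1 < _)%N) ?prednK ?size_poly_gt0 //.
apply/leq_sizeP => j; rewrite leq_eqVlt => /predU1P[<-|ltj].
  by rewrite coefB -{2}eqs -!/(lead_coef _) !lead // subrr.
rewrite coefB !nth_default ?subr0 ?eqs //.
- by move: ltj; case: (size Q).
- by move: ltj; case: (size Q).
Qed.

Lemma geomX_mul (R : comNzRingType) (a : R) (N : nat) :
  (1 - a *: 'X) * ('X * \sum_(i < N) (a *: 'X) ^+ i)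
    = 'X * (1 - (a *: 'X) ^+ N) :> {poly R}.
Proof. by rewrite -[1 - _ ^+ N]opprB subrX1; ring. Qed.

(** Squaring is additive in characteristic 2, so [T ^+ 2] is the same sum with its index shifted by
    one. This is the source of the quadratic equation. *)
Lemma telescope_pchar2 (R : comNzRingType) (A : R) (N : nat) :
  2%N \in [pchar R] ->
  let T := \sum_(k < N) A ^+ (2 ^ k) in T - T ^+ 2 = A - A ^+ (2 ^ N).
Proof.
move=> c2; elim: N => [|N IH] /=; first by rewrite big_ord0 expn0 expr1 expr0n /= !subrr.
rewrite big_ord_recr /= -(pFrobenius_autE c2) rmorphD /= !pFrobenius_autE.
rewrite opprD addrACA IH -exprM -expnSr; ring.
Qed.

(* With T the sum, 1 - 'X times the norm (Q T - P) (Q (1 - T) + P) of Q T - P is,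
   modulo 'X^N, a nonzero polynomial of degree at most 2n + 1 < N. *)
Lemma polyF2_approx_order (F : fieldType) (F2 : forall c : F, c != 0 -> c = 1)
    (n : nat) (P Q H : {poly F}) (N := n.*2.+2)
    (A : {poly F} := 'X * \sum_(i < N) 'X ^+ i) :
  Q != 0 -> (size Q <= n.+1)%N -> (size P <= n.+1)%N ->
  Q * \sum_(k < N) A ^+ (2 ^ k) != P + 'X^N * H.
Proof.
move=> Q0 sQ sP; apply/eqP; set T := \sum_(k < N) _ => E.
have c2 : 2%N \in [pchar {poly F}].
  rewrite pchar_poly inE /= mulr2n -[X in _ + X]opprK.
  by rewrite (F2 (- 1)) ?oppr_eq0 ?oner_eq0 // subrr.
have TT : T - T ^+ 2 = A - A ^+ (2 ^ N) := telescope_pchar2 A N c2.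
have AE : (1 - 'X) * A = 'X * (1 - 'X^N).
  by have := geomX_mul (1 : F) N; rewrite scale1r.
(* [A] is divisible by ['X] and [N <= 2 ^ N], so the boundary term of the telescoping vanishes
   modulo ['X^N]. *)
have [W AW] : exists W, A ^+ (2 ^ N) = 'X^N * W.
  rewrite exprMn -(subnKC (ltnW (ltn_expl N (isT : (1 < 2)%N)))) exprD -mulrA.
  by eexists.
(* The cofactor of ['X^N] left after substituting [P + 'X^N * H] for [Q * T] in the quadratic
   equation. *)
pose K := Q ^+ 2 * ('X + (1 - 'X) * W)
          + (1 - 'X) * (Q * H - 2 * P * H - 'X^N * H ^+ 2).
have KE : 'X * Q ^+ 2 - (1 - 'X) * P * (Q - P) = 'X^N * K.
  have E2 : (1 - 'X) * (Q * (Q * T) - (Q * T) ^+ 2)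
     = Q ^+ 2 * ('X * (1 - 'X^N) - (1 - 'X) * ('X^N * W)).
    rewrite -AW -AE -mulrBr -TT; ring.
  rewrite E in E2; apply/eqP; rewrite -subr_eq0.
  move/eqP: E2; rewrite -subr_eq0 -oppr_eq0 => /eqP <-; rewrite /K.
  by apply/eqP; ring.
have /eqP[] := polyF2_norm_neq F2 P Q0; apply/eqP; rewrite -subr_eq0 KE.
have [->|K0] := eqVneq K 0; first by rewrite mulr0.
have : (size ('X^N * K)%R <= n.*2.+2)%N.
  rewrite -KE (leq_trans (size_polyD _ _)) // size_polyN geq_max.
  have sX : size (1 - 'X : {poly F}) = 2%N.
    by rewrite -opprB size_polyN size_XsubC.
  have sQP : (size (Q - P)%R <= n.+1)%N.
    by rewrite (leq_trans (size_polyD _ _)) // size_polyN geq_max sQ.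
  have m (p q : {poly F}) a b : (size p <= a.+1)%N -> (size q <= b.+1)%N ->
      (size (p * q)%R <= (a + b).+1)%N.
    by move=> pa qb; rewrite (leq_trans (size_polyMleq _ _)) //; lia.
  apply/andP; split.
    by rewrite (leq_trans (m _ _ 1%N (n + n)%N _ (m _ _ _ _ sQ sQ))) ?size_polyX //; lia.
  by rewrite (leq_trans (m _ _ (1 + n)%N n (m _ _ 1%N _ _ sP) sQP)) ?sX //; lia.
rewrite mulrC size_mulXn // /N; have : (0 < size K)%N by rewrite size_poly_gt0.
by lia.
Qed.

(** * Integral approximants of Padé type *)

(** The [n + 1] coefficients of [Q] satisfy only [n] linear conditions, so a nonzero rational
    solution exists; it is then made integral and primitive. Primitivity keeps [Q] nonzero modulo
    2. *)
Lemma exists_primitive_denominator (T : {poly int}) (n : nat) :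
  exists Q : {poly int}, [/\ zcontents Q = 1, (size Q <= n.+1)%N &
    forall i, (n < i <= n.*2)%N -> (Q * T)`_i = 0].
Proof.
pose Tq : {poly rat} := map_poly intr T.
(* A row vector times [M] lists the coefficients of degrees [n + 1] to [2n] of the product of its
   polynomial with [T]. *)
pose M : 'M[rat]_(n.+1, n) := \matrix_(i, j) ('X^i * Tq)`_(n.+1 + j).
have : kermx M != 0.
  rewrite kermx_eq0 /row_free neq_ltn.
  by rewrite (leq_ltn_trans (rank_leq_col M)).
case/rowV0Pn => v /sub_kermxP vM v0.
have [q [a a0 qE]] := rat_poly_scale (rVpoly v).
have q0 : q != 0.
  apply: contraNneq v0 => q0; rewrite -[v]rVpolyK qE q0 rmorph0 scaler0.
  by rewrite linear0.
have aq0 : (a%:~R : rat) != 0 by rewrite intr_eq0.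
have sq : (size q <= n.+1)%N.
  have -> : size q = size (rVpoly v).
    by rewrite qE size_scale ?invr_eq0 // size_map_inj_poly //; exact: intr_inj.
  exact: size_poly.
exists (zprimitive q); split=> [||i /andP[ni in2]].
- by rewrite zcontents_primitive q0.
- by rewrite size_zprimitive.
have c0 : zcontents q != 0 by rewrite zcontents_eq0.
have ij : (i - n.+1 < n)%N by lia.
have := congr1 (fun w : 'rV_n => w 0 (Ordinal ij)) vM.
rewrite !mxE (_ : \sum_j _ = (rVpoly v * Tq)`_i); last first.
  rewrite /rVpoly poly_def mulr_suml coef_sum; apply: eq_bigr => k _.
  rewrite -scalerAl coefZ !mxE valK /= subnKC //.
move/eqP; rewrite qE -scalerAl coefZ mulf_eq0 invr_eq0 (negPf aq0) /=.
rewrite -rmorphM coef_map /= intr_eq0 [in X in X -> _](zpolyEprim q).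
by rewrite -scalerAl coefZ mulf_eq0 (negPf c0) => /eqP.
Qed.

Lemma expr_sum_pchar (R : comNzRingType) (p : nat) (I : Type) (r : seq I)
    (f : I -> R) (k : nat) : p \in [pchar R] ->
  (\sum_(i <- r) f i) ^+ (p ^ k) = \sum_(i <- r) f i ^+ (p ^ k).
Proof.
move=> cp; elim: k => [|k IH].
  by rewrite expn0 expr1; apply: eq_bigr => i _; rewrite expr1.
rewrite expnSr exprM IH -(pFrobenius_autE cp) rmorph_sum.
by apply: eq_bigr => i _; rewrite /= pFrobenius_autE exprM.
Qed.

(** A truncation of the expansion of [z / (1 - e z)], exact up to degree [N]. *)
Definition geomX (e : int) (N : nat) : {poly int} :=
  'X * \sum_(i < N) (e *: 'X) ^+ i.

(* Agrees with the power series sum_k z^(2^k) / (1 - e z^(2^k)) up to order N. *)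
Definition lambertX (e : int) (N : nat) : {poly int} :=
  \sum_(k < N) (geomX e N \Po 'X^(2 ^ k)).

(** Modulo 2 the signs [e = 1] and [e = -1] coincide, and substituting ['X^(2 ^ k)] amounts to
    raising to the power [2 ^ k]. *)
Lemma map_lambertX_pchar2 (F : fieldType) (e : int) (N : nat)
    (A : {poly F} := 'X * \sum_(i < N) 'X ^+ i) :
  (forall c : F, c != 0 -> c = 1) -> 2%N \in [pchar F] -> e ^+ 2 = 1 ->
  map_poly intr (lambertX e N) = \sum_(k < N) A ^+ (2 ^ k).
Proof.
move=> F2 c2 e2; rewrite /lambertX rmorph_sum /=; apply: eq_bigr => k _.
have e1 : e%:~R = 1 :> F.
  apply: F2; apply/eqP => e0; have := congr1 (fun c : int => c%:~R : F) e2.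
  by rewrite rmorphXn /= e0 expr0n => /eqP; rewrite eq_sym oner_eq0.
rewrite map_comp_poly /geomX rmorphM rmorph_sum /= map_polyX map_polyXn.
have -> : \sum_(i < N) map_poly intr ((e *: 'X) ^+ i) = \sum_(i < N) 'X^i :> {poly F}.
  by apply: eq_bigr => i _; rewrite rmorphXn /= map_polyZ map_polyX /= e1 scale1r.
rewrite comp_polyM comp_polyX linear_sum /= exprMn; congr (_ * _).
rewrite expr_sum_pchar ?pchar_poly //; apply: eq_bigr => i _.
by rewrite rmorphXn /= comp_polyX -!exprM mulnC.
Qed.

Lemma poly_take_drop_gap (R : nzRingType) (p : {poly R}) (m n : nat) : (m <= n)%N ->
  (forall i, (m <= i < n)%N -> p`_i = 0) ->
  p = take_poly m p + 'X^n * drop_poly n p.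
Proof.
move=> mn p0; apply/polyP => i; rewrite coefD coefXnM coef_take_poly coef_drop_poly.
case: ltnP => im; last case: ltnP => ni.
- by rewrite ifT ?addr0 //; apply: leq_trans mn.
- by rewrite p0 ?addr0 // im.
- by rewrite add0r subnK.
Qed.

(** [P] and [H] are the parts of [Q * T] below and above the gap in degrees [n + 1] to [2n]. If [H]
    had zero constant term, the gap would include [2n + 1], and reduction modulo 2 would contradict
    [polyF2_approx_order]. *)
Lemma lambertX_pade (e : int) (n : nat) (T := lambertX e n.*2.+2) : e ^+ 2 = 1 ->
  exists P Q H : {poly int}, [/\ (size P <= n.+1)%N, (size Q <= n.+1)%N,
    Q * T = P + 'X^(n.*2.+1) * H & H`_0 != 0].
Proof.
move=> e2; have [Q [cQ sQ QT0]] := exists_primitive_denominator T n.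
exists (take_poly n.+1 (Q * T)), Q, (drop_poly n.*2.+1 (Q * T)).
split=> //; first exact: size_take_poly.
  by apply: poly_take_drop_gap => [|i ?]; [lia|apply: QT0; lia].
rewrite coef_drop_poly add0n; apply/eqP => QT1.
have F2 (c : 'F_2) : c != 0 -> c = 1.
  by case: c => -[|[|//]] i //= _; exact: val_inj.
have c2 : 2%N \in [pchar 'F_2] by rewrite pchar_Fp.
pose f (p : {poly int}) : {poly 'F_2} := map_poly intr p.
have fQ : f Q != 0.
  apply/eqP => fQ0; have : (2 %| zcontents Q)%Z.
    rewrite dvdz_contents; apply/polyOverP => i.
    have := congr1 (fun p : {poly 'F_2} => p`_i) fQ0.
    by rewrite coef_map coef0 /= => /eqP; rewrite -(dvdz_pcharf c2).
  by rewrite cQ.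
have fsz (p : {poly int}) : (size (f p) <= size p)%N by exact: size_poly.
have /eqP[] := polyF2_approx_order F2 (drop_poly n.*2.+2 (f (Q * T))) fQ
  (leq_trans (fsz _) sQ) (leq_trans (fsz _) (size_take_poly n.+1 (Q * T))).
rewrite -(map_lambertX_pchar2 _ F2 c2 e2) -rmorphM /=.
rewrite [LHS](@poly_take_drop_gap _ _ n.+1 n.*2.+2); [|lia|].
  congr (_ + _); apply/polyP => i.
  by rewrite coef_take_poly !coef_map coef_take_poly /=; case: ifP => // _; rewrite rmorph0.
move=> i ni; rewrite coef_map /=.
have [->|ne] := eqVneq i n.*2.+1; first by rewrite QT1 rmorph0.
by rewrite QT0 ?rmorph0 //; lia.
Qed.

(** * Evaluation at the inverse of [b^(2^m)] *)

Lemma horner_bounded (R : realFieldType) (p : {poly R}) :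
  exists2 B : R, 0 < B & forall y, `|y| <= 1 -> `|p.[y]| <= B.
Proof.
elim/poly_ind: p => [|p c [B B0 pB]]; first by exists 1 => // y _; rewrite horner0 normr0.
exists (B + `|c|) => [|y y1]; first by rewrite ltr_pwDl.
rewrite hornerMXaddC (le_trans (ler_normD _ _)) // lerD2r normrM.
by rewrite -[leRHS]mulr1 ler_pM // pB.
Qed.

Lemma horner_sub_coef0_bounded (R : realFieldType) (p : {poly R}) :
  exists2 B : R, 0 < B & forall y, `|y| <= 1 -> `|p.[y] - p`_0| <= B * `|y|.
Proof.
elim/poly_ind: p => [|p c _].
  by exists 1 => // y _; rewrite horner0 coef0 subr0 normr0 mulr_ge0.
have [B B0 pB] := horner_bounded p; exists B => // y y1.
rewrite hornerMXaddC coefD coefMX coefC /= add0r addrK normrM.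
by rewrite ler_wpM2r // pB.
Qed.

Lemma exprn_horner_inv_int (R : numFieldType) (p : {poly int}) (n : nat) (X : int) :
  (size p <= n.+1)%N -> X != 0 ->
  exists z : int, X%:~R ^+ n * (map_poly intr p).[X%:~R^-1] = z%:~R :> R.
Proof.
move=> sp X0; exists (\sum_(i < n.+1) p`_i * X ^+ (n - i)).
have XR0 : X%:~R != 0 :> R by rewrite intr_eq0.
rewrite (@horner_coef_wide _ n.+1) ?(leq_trans (size_poly _ _)) // mulr_sumr.
rewrite rmorph_sum; apply: eq_bigr => i _ /=.
rewrite coef_map /= rmorphM rmorphXn /= mulrCA exprVn; congr (_ * _).
rewrite -expfB_cond; first by [].
by rewrite (negPf XR0) add0n -ltnS ltn_ord.
Qed.

(** With [u = b^(2^m)], the factorization [u^2 - 1 = (u - 1)(u + 1)] carries the earlier terms along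
    and [u^2 - 1 = (u - e)(u + e)] clears the new one. *)
Lemma sum_inv_den (R : numFieldType) (e : int) (b m : nat) : e ^+ 2 = 1 -> (2 <= b)%N ->
  exists a : int, (b%:R ^+ (2 ^ m) - 1) *
    \sum_(k < m) (b%:R ^+ (2 ^ k) - e%:~R)^-1 = a%:~R :> R.
Proof.
move=> e2 b2; elim: m => [|m [a IH]]; first by exists 0; rewrite big_ord0 mulr0.
set u := b%:R ^+ (2 ^ m) : R in IH.
have uE : u = (b ^ (2 ^ m))%N%:R by rewrite natrX.
have u1 : 1 < u.
  rewrite uE (ltr_nat _ 1) (leq_trans b2) // -[leqLHS]expn1 leq_pexp2l ?expn_gt0 //.
  by lia.
have e2R : e%:~R ^+ 2 = 1 :> R by rewrite -rmorphXn e2.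
exists ((Posz (b ^ (2 ^ m)) + 1) * a + (Posz (b ^ (2 ^ m)) + e)).
rewrite big_ord_recr /= -/u expnSr exprM -/u.
rewrite !(rmorphD, rmorphM, rmorph1) /= -IH -[(Posz _)%:~R]/(_%:R) -uE.
have ue : u - e%:~R != 0.
  have : (e - 1) * (e + 1) = 0 by rewrite -subr_sqr e2 expr1n subrr.
  move/eqP; rewrite mulf_eq0 subr_eq0 [e + 1 == 0]addr_eq0 => /orP[] /eqP ->.
    by rewrite gt_eqF // subr_gt0.
  by rewrite mulrN1z opprK gt_eqF // addr_gt0 // (lt_trans _ u1).
set S := \sum_(k < m) _.
have -> : u ^+ 2 - 1 = (u - e%:~R) * (u + e%:~R) by rewrite -subr_sqr e2R.
rewrite mulrDr [_ * (u + _) * _^-1]mulrAC divff // mul1r; congr (_ + _).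
by rewrite -subr_sqr e2R -[1 in LHS](expr1n _ 2) subr_sqr mulrAC mulrC mulrA.
Qed.

(* alpha = sum_k 1 / (b^(2^k) - e), in the form of a bound on the tails. *)
Definition lambert_value (R : realType) (b : nat) (e : int) (alpha : R) :=
  forall K, `|alpha - \sum_(k < K) (b%:R ^+ (2 ^ k) - e%:~R)^-1|
            <= 4 / b%:R ^+ (2 ^ K).

(** The remainder is [t (e t)^N / (1 - e t)], and [t <= 1/2 <= 1 - e t] bounds the factor
    [t / (1 - e t)] by 1. *)
Lemma geomX_tail (R : realFieldType) (e : int) (N : nat) (t : R) :
  e ^+ 2 = 1 -> 0 <= t <= 2^-1 ->
  `|t / (1 - e%:~R * t) - (map_poly intr (geomX e N)).[t]| <= t ^+ N.
Proof.
move=> e2 /andP[t0 t2]; set E := e%:~R : R.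
have E1 : `|E| = 1.
  have : `|E| ^+ 2 = 1 by rewrite -normrX -rmorphXn e2 normr1.
  by move/eqP; rewrite expr2 -expr2 sqrp_eq1 ?normr_ge0 // => /eqP.
have zt : `|E * t| = t by rewrite normrM E1 mul1r ger0_norm.
have z1 : 2^-1 <= 1 - E * t by have := ler_norm (E * t); rewrite zt; lra.
have z0 : 1 - E * t != 0 by apply: lt0r_neq0; lra.
have GE : (1 - E * t) * (map_poly intr (geomX e N)).[t] = t * (1 - (E * t) ^+ N).
  have := congr1 (fun p : {poly int} => (map_poly (intr : int -> R) p).[t]) (geomX_mul e N).
  rewrite -/(geomX e N) !rmorphM !rmorphB rmorphXn !rmorph1 /= map_polyZ map_polyX /=.
  by rewrite !hornerE.
have -> : t / (1 - E * t) - (map_poly intr (geomX e N)).[t]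
    = t * (E * t) ^+ N / (1 - E * t).
  apply: (mulfI z0); rewrite mulrBr GE; field; exact: z0.
rewrite 2!normrM normfV normrX zt !ger0_norm //; last by lra.
rewrite mulrAC -[leRHS]mul1r ler_wpM2r ?exprn_ge0 // ler_pdivrMr; lra.
Qed.

(** Each of the [N] terms with index from [m] to [m + N - 1] is truncated at a cost of at most
    [y ^+ N]; the terms beyond contribute at most [4 y^(2^N)], hence at most [4 y^N]. *)
Lemma lambertX_tail (R : realType) (b : nat) (e : int) (alpha : R) (m N : nat)
    (y : R := (b%:R ^+ (2 ^ m))^-1) :
  (2 <= b)%N -> e ^+ 2 = 1 -> lambert_value b e alpha ->
  `|alpha - \sum_(k < m) (b%:R ^+ (2 ^ k) - e%:~R)^-1
     - (map_poly intr (lambertX e N)).[y]| <= (N%:R + 4) * y ^+ N.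
Proof.
move=> b2 e2 al; have bR : 2 <= b%:R :> R by rewrite ler_nat.
have b0 : 0 < b%:R :> R by lra.
have yk k : y ^+ (2 ^ k) = (b%:R ^+ (2 ^ (m + k)))^-1.
  by rewrite /y exprVn -exprM -expnD.
have yk2 k : 0 <= y ^+ (2 ^ k) <= 2^-1.
  have u2 : 2 <= b%:R ^+ (2 ^ (m + k)) :> R.
    by rewrite (le_trans bR) // -[leLHS]expr1 ler_weXn2l ?expn_gt0 //; lra.
  by rewrite yk invr_ge0 lef_pV2 ?posrE ?u2 //; lra.
have /andP[y0 y2] : 0 <= y <= 2^-1 by have := yk2 0%N; rewrite expn0 expr1.
have y1 : y <= 1 by lra.
have yN k : y ^+ (2 ^ k) ^+ N <= y ^+ N.
  by rewrite -exprM ler_wiXn2l // leq_pmull ?expn_gt0.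
have := al (m + N)%N; rewrite big_split_ord /= => al'.
have -> : (map_poly intr (lambertX e N)).[y]
    = \sum_(k < N) (map_poly intr (geomX e N)).[y ^+ (2 ^ k)].
  rewrite /lambertX rmorph_sum horner_sum; apply: eq_bigr => k _ /=.
  by rewrite map_comp_poly horner_comp map_polyXn hornerXn.
set A := \sum_(k < m) _ in al' *; set B := \sum_(k < N) _ in al'.
set D := \sum_(k < N) _.
have BD : `|B - D| <= N%:R * y ^+ N.
  rewrite /B /D -sumrB (le_trans (ler_norm_sum _ _ _)) //.
  rewrite -[X in X%:R * _](card_ord N) -sum1_card natr_sum mulr_suml ler_sum // => k _.
  rewrite mul1r (le_trans _ (yN k)) // (le_trans _ (geomX_tail _ e2 (yk2 k))) //.
  rewrite le_eqVlt; apply/orP; left; apply/eqP; congr (`|_ - _|).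
  rewrite yk; set u := b%:R ^+ _.
  have u0 : u != 0 by rewrite expf_neq0 // lt0r_neq0.
  have -> : 1 - e%:~R * u^-1 = (u - e%:~R) / u by rewrite mulrBl divff.
  by rewrite invf_div mulrA mulVf // mul1r.
have r : 4 / b%:R ^+ (2 ^ (m + N)) <= 4 * y ^+ N.
  rewrite -yk ler_pM2l // ler_wiXn2l // ltnW // ltn_expl //.
have -> : alpha - A - D = (alpha - (A + B)) + (B - D) by ring.
by rewrite (le_trans (ler_normD _ _)) // addrC mulrDl lerD // (le_trans al').
Qed.

(** * Integer approximations of exact order *)

(** The constants may depend on [n] but not on [m]. The bound below by [c] makes the linear form
    nonzero and controls fractions equal to [p/q]. *)
Definition well_approximated (R : realType) (b : nat) (alpha : R) (n : nat) :=
  exists C c : R, exists m0 : nat, [/\ 0 < C, 0 < c &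
    forall m, (m0 <= m)%N -> exists p q : int,
      let X : R := b%:R ^+ (2 ^ m) in
      `|q%:~R| <= C * X ^+ n.+1 /\ c <= X ^+ n * `|q%:~R * alpha - p%:~R| <= C].

(** The identity [Q T = P + x^(2n+1) H] is evaluated at [1/X] and multiplied by [X^n (X - 1)]. With
    [N = 2n + 2] the truncation error is one power of [X] below the main term [h X^(-2n-1)]. *)
Lemma lambert_well_approximated (R : realType) (b : nat) (e : int) (alpha : R) (n : nat) :
  (2 <= b)%N -> e ^+ 2 = 1 -> lambert_value b e alpha -> well_approximated b alpha n.
Proof.
move=> b2 e2 al; set N := n.*2.+2.
have [P [Q [H [sP sQ QT H0]]]] := lambertX_pade n e2.
pose f (p : {poly int}) : {poly R} := map_poly intr p.
have [BQ BQ0 bQ] := horner_bounded (f Q).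
have [BH BH0 bH] := horner_sub_coef0_bounded (f H).
pose h : R := (f H)`_0.
have h1 : 1 <= `|h|.
  by rewrite /h coef_map -intr_norm -[1]/(1%:~R) ler_int -gtz0_ge1 normr_gt0.
pose K := BH + BQ * (N%:R + 4).
have N0 : 0 <= N%:R :> R by rewrite ler0n.
have K0 : 0 < K by rewrite addr_gt0 // mulr_gt0 //; lra.
have bR : 2 <= b%:R :> R by rewrite ler_nat.
(* [K / X] bounds the total error relative to [h]; the threshold makes it at most 1/2, while
   [|h| >= 1]. The constant 1/4 is the product of this remaining 1/2 and of [(X - 1) / X >= 1/2]. *)
exists (`|h| + 2^-1 + BQ), 4^-1, (Num.bound (K * 2)).
split=> [||m mK]; [by lra|by lra|].
pose X : R := b%:R ^+ (2 ^ m); pose y := X^-1.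
have XE : X = (Posz (b ^ (2 ^ m)))%:~R by rewrite /X -natrX.
have X2 : 2 <= X.
  by rewrite (le_trans bR) // -[leLHS]expr1 ler_weXn2l ?expn_gt0 //; lra.
have X0 : X != 0 by apply: lt0r_neq0; lra.
have Xge0 : 0 <= X by lra.
have Xge1 : 0 <= X - 1 by lra.
have X1X : X - 1 <= X by lra.
have C_ge : BQ <= `|h| + 2^-1 + BQ by lra.
have w0 k : 0 <= X ^+ k by rewrite exprn_ge0.
have y2 : X^-1 <= 2^-1 by rewrite lef_pV2 ?posrE //; lra.
have XK : K * 2 <= X.
  have := archi_boundP (ltW (mulr_gt0 K0 (ltr0n R 2))); rewrite -[_ * 2%:R]/(K * 2) => Kb.
  rewrite (le_trans (ltW Kb)) // XE ler_nat (leq_trans mK) //.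
  rewrite (leq_trans (ltnW (ltn_expl m (isT : (1 < 2)%N)))) //.
  by rewrite ltnW // ltn_expl.
have y0 : 0 < y by rewrite invr_gt0; lra.
have y1 : `|y| <= 1 by rewrite gtr0_norm // invf_le1; lra.
have Ky : K * y <= 2^-1 by rewrite ler_pdivrMr; lra.
have Xz : Posz (b ^ (2 ^ m)) != 0 by rewrite -(intr_eq0 R) -XE.
have [zQ zQE] := exprn_horner_inv_int R sQ Xz.
have [zP zPE] := exprn_horner_inv_int R sP Xz.
rewrite -XE -/y -/(f _) in zQE zPE.
have [a aE] := sum_inv_den R m e2 b2; rewrite -/X in aE.
have := lambertX_tail m N b2 e2 al; rewrite -/X -/y -/(f _).
set S := \sum_(k < m) _ in aE *; set T := (f _).[y] => tail.
exists (zQ * a + (Posz (b ^ (2 ^ m)) - 1) * zP), ((Posz (b ^ (2 ^ m)) - 1) * zQ).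
rewrite /= !(rmorphD, rmorphM, rmorphB, rmorph1) /= -XE -zQE -zPE -aE.
set Qy := (f Q).[y] in zQE *; set Py := (f P).[y] in zPE *.
have qy : `|Qy| <= BQ by exact: bQ.
split.
  rewrite !normrM normrX [`|X - 1|]ger0_norm // [`|X|]ger0_norm //.
  rewrite exprS [leRHS]mulrC -mulrA.
  rewrite ler_pM ?mulr_ge0 // ler_wpM2l //.
  exact: le_trans C_ge.
(* After scaling by [X^(2n+1)], the error has two sources: the higher coefficients of [H] and the
   truncation. *)
pose d := (f H).[y] - h + Qy * (alpha - S - T) * X ^+ n.*2.+1.
have QTy : Qy * T = Py + y ^+ n.*2.+1 * (f H).[y].
  by rewrite /Qy /T /Py /f -hornerM -rmorphM QT rmorphD rmorphM /= map_polyXn !hornerE.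
have yX k : y ^+ k * X ^+ k = 1 by rewrite -exprMn mulVf // expr1n.
have dK : `|d| <= 2^-1.
  rewrite (le_trans (ler_normD _ _)) // (le_trans _ Ky) // /K mulrDl lerD //.
    by rewrite (le_trans (bH y y1)) // gtr0_norm.
  rewrite !normrM normrX [`|X|]ger0_norm //.
  rewrite -!mulrA ler_pM // ?mulr_ge0 //.
  rewrite (le_trans (ler_wpM2r (w0 _) tail)) //.
  by rewrite /N exprS [y * _]mulrC -!mulrA [y * X ^+ _]mulrC [_ ^+ _ * (_ * y)]mulrA yX mul1r.
have main : X ^+ n * ((X - 1) * (X ^+ n * Qy) * alpha
    - (X ^+ n * Qy * ((X - 1) * S) + (X - 1) * (X ^+ n * Py)))
    = (X - 1) * y * (h + d).
  have -> : h + d = X ^+ n.*2.+1 * (Qy * (alpha - S) - Py).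
    have -> : h + d = (f H).[y] + Qy * (alpha - S - T) * X ^+ n.*2.+1.
      by rewrite /d; ring.
    rewrite -[(f H).[y]]mul1r -(yX n.*2.+1) mulrAC.
    have -> : y ^+ n.*2.+1 * (f H).[y] = Qy * T - Py by rewrite QTy; ring.
    by ring.
  rewrite exprS -addnn exprD; move: (yX 1%N); rewrite !expr1 => yX1.
  have -> : (X - 1) * y * (X * (X ^+ n * X ^+ n) * (Qy * (alpha - S) - Py))
    = (y * X) * ((X - 1) * (X ^+ n * X ^+ n) * (Qy * (alpha - S) - Py)) by ring.
  by rewrite yX1; ring.
have Xy : 2^-1 <= (X - 1) * y <= 1.
  by rewrite mulrBl mul1r divff //; move: y0 y2; rewrite -/y; clear; lra.
have -> : X ^+ n * `|(X - 1) * (X ^+ n * Qy) * alpha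
    - (X ^+ n * Qy * ((X - 1) * S) + (X - 1) * (X ^+ n * Py))|
    = (X - 1) * y * `|h + d|.
  rewrite -{1}[X ^+ n]ger0_norm // -normrM main normrM ger0_norm //.
  by rewrite mulr_ge0 // ltW.
have hd1 : 2^-1 <= `|h + d|.
  by move: (lerB_normD h d) dK h1; clear; lra.
have hd2 := ler_normD h d.
move: Xy hd1 hd2 dK BQ0; clear; move: ((X - 1) * y) `|h + d| => u v /andP[u1 u2] v1 v2 d2 Q0.
apply/andP; split; first nra.
by rewrite (le_trans (ler_piMl _ u2)); lra.
Qed.

(** * Diophantine consequences *)

Lemma pow2_pow_unbounded (R : archiRealFieldType) (b : nat) (M : R) : (2 <= b)%N ->
  exists m0 : nat, forall m, (m0 <= m)%N -> M < b%:R ^+ (2 ^ m).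
Proof.
move=> b2; exists (Num.bound `|M|) => m mM.
rewrite (le_lt_trans (ler_norm M)) // (lt_le_trans (archi_boundP (normr_ge0 M))) //.
rewrite -natrX ler_nat (leq_trans mM) //.
rewrite (leq_trans (ltnW (ltn_expl m (isT : (1 < 2)%N)))) //.
by rewrite ltnW // ltn_expl.
Qed.

(** Finitely many [n] share constants: the values of [C] are added, and the least [c] and the
    largest [m0] are taken. *)
Lemma well_approximated_uniform (R : realType) (b : nat) (alpha : R) (N : nat) :
  (2 <= b)%N -> (forall n, well_approximated b alpha n) ->
  exists C c : R, exists m0 : nat, [/\ 0 < C, 0 < c &
    forall n m, (n < N)%N -> (m0 <= m)%N -> exists p q : int,
      let X : R := b%:R ^+ (2 ^ m) in
      `|q%:~R| <= C * X ^+ n.+1 /\ c <= X ^+ n * `|q%:~R * alpha - p%:~R| <= C].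
Proof.
move=> b2 wa; elim: N => [|N [C [c [m0 [C0 c0 IH]]]]]; first by exists 1, 1, 0%N.
have [C' [c' [m1 [C1 c1 wN]]]] := wa N.
exists (C + C'), (Num.min c c'), (maxn m0 m1).
split; [exact: addr_gt0|by rewrite lt_min c0|move=> n m nN].
rewrite geq_max => /andP[mm0 mm1].
have X0 : 0 <= b%:R ^+ (2 ^ m) :> R by rewrite exprn_ge0.
have := nN; rewrite ltnS leq_eqVlt => /predU1P[->|lt].
  have [p [q [h1 /andP[h2 h3]]]] := wN m mm1; exists p, q; split.
    by rewrite (le_trans h1) // ler_wpM2r ?exprn_ge0 // lerDr ltW.
  by rewrite ge_min h2 orbT (le_trans h3) // lerDr ltW.
have [p [q [h1 /andP[h2 h3]]]] := IH n m lt mm0; exists p, q; split.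
  by rewrite (le_trans h1) // ler_wpM2r ?exprn_ge0 // lerDl ltW.
by rewrite ge_min h2 (le_trans h3) // lerDl ltW.
Qed.

(* The last bound is |q alpha - p| < q^(-k/(k+2)) with integral exponents. *)
Lemma exists_good_approximation (R : realType) (b : nat) (alpha : R) (k : nat) (d : R) :
  (2 <= b)%N -> well_approximated b alpha k.+1 -> 0 < d ->
  exists (p : int) (q : nat), [/\ (0 < q)%N, 0 < `|q%:R * alpha - p%:~R| < d &
    `|q%:R * alpha - p%:~R| ^+ k.+2 * q%:R ^+ k < 1].
Proof.
move=> b2 [C [c [m0 [C0 c0 wa]]]] d0.
(* The summands serve in turn to get [w < d], to absorb the constant in the power inequality, to
   exclude [q = 0], and to have [X > 1]. *)
have [m1 hm1] := pow2_pow_unbounded (C / d + C ^+ (k.+2 + k) + C + 1) b2.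
have [p [q []]] := wa _ (leq_maxl m0 m1).
set X := b%:R ^+ _; have : C / d + C ^+ (k.+2 + k) + C + 1 < X by apply/hm1/leq_maxr.
move: X => X XM qC /andP[cX XC]; set w := `|_| in cX XC.
have Cd0 : 0 < C / d by rewrite divr_gt0.
have Ck0 : 0 < C ^+ (k.+2 + k) by rewrite exprn_gt0.
have X1 : 1 < X by lra.
have X0 : 0 < X by lra.
have w0 : 0 < w.
  by rewrite -(pmulr_rgt0 _ (exprn_gt0 k.+1 X0)) (lt_le_trans c0).
have wd : w < d.
  have CX : C < d * X by rewrite mulrC -ltr_pdivrMr //; lra.
  rewrite -(ltr_pM2l (exprn_gt0 k.+1 X0)) (le_lt_trans XC) // (lt_le_trans CX) //.
  rewrite mulrC ler_pM2r // -[leLHS]expr1 ler_weXn2l //; lra.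
(* The powers of [X] combine to [X^(k(k+2) - (k+1)(k+2)) = X^(-(k+2))], which beats [C^(2k+2)]. *)
have wk : w ^+ k.+2 * `|q%:~R| ^+ k < 1.
  have e1 : (X ^+ k.+1 * w) ^+ k.+2 <= C ^+ k.+2.
    by rewrite lerXn2r // ?nnegrE ?mulr_ge0 ?exprn_ge0 // ltW.
  have e2 : `|q%:~R| ^+ k <= (C * X ^+ k.+2) ^+ k.
    have CX0 : 0 <= C * X ^+ k.+2 by rewrite mulr_ge0 ?exprn_ge0 ?ltW.
    by rewrite lerXn2r ?nnegrE.
  have e3 : X ^+ (k.+1 * k.+2) = X * X ^+ k.+1 * X ^+ (k.+2 * k).
    by rewrite mulSn exprD exprS [(k * _)%N]mulnC.
  rewrite -(ltr_pM2l (exprn_gt0 (k.+1 * k.+2) X0)) mulr1 mulrA exprM -exprMn.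
  have e0 : 0 <= (X ^+ k.+1 * w) ^+ k.+2 by rewrite exprn_ge0 ?mulr_ge0 ?exprn_ge0 ?ltW.
  rewrite (le_lt_trans (ler_pM e0 _ e1 e2)) ?exprn_ge0 //.
  rewrite exprMn mulrA -exprD -!exprM e3 ltr_pM2r ?exprn_gt0 //.
  rewrite (@lt_le_trans _ _ X) //; first by move: XM Cd0 C0; clear; lra.
  by rewrite ler_peMr ?exprn_ege1 // ltW.
have q0 : q != 0.
  apply/eqP => q0; move: w0 XC; rewrite /w q0 mul0r sub0r normrN => p0 XC.
  have p1 : 1 <= `|p%:~R| :> R.
    by move: p0; rewrite -intr_norm -[1]/(1%:~R) ler_int -gtz0_ge1 ltr0z.
  have : X <= X ^+ k.+1 * `|p%:~R|.
    rewrite exprSr -mulrA (@le_trans _ _ (X * `|p%:~R|)) ?ler_peMr ?(ltW X0) //.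
    by rewrite ler_peMl ?exprn_ege1 ?mulr_ge0 ?(ltW X0) ?(ltW X1).
  by move: XM XC Ck0 Cd0; clear; lra.
pose s : int := sgz q.
exists (s * p), `|q|%N.
have wE : `| `|q|%N%:R * alpha - (s * p)%:~R| = w.
  rewrite (_ : `|q|%N%:R = (s * q)%:~R); last first.
    by rewrite /s -[sgz q * q]normrEsg.
  rewrite !rmorphM /= -mulrA -mulrBr normrM -intr_norm normr_sgz q0 mul1r.
  by [].
rewrite wE w0 wd; split=> //; first by rewrite lt0n absz_eq0.
by move: wk; rewrite -intr_norm -[`|q|]abszE.
Qed.

(** Constants are absorbed at the cost of one extra factor [Q]. *)
Lemma mulr_gt1_of_le (R : realFieldType) (u E Q G : R) :
  0 < u -> 0 <= G -> u <= E * G -> E < Q * u -> 1 < Q * G.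
Proof.
move=> u0; rewrite le_eqVlt => /predU1P[<-|G0 uE EQ].
  by rewrite mulr0 leNgt u0.
rewrite -(ltr_pM2l u0) mulr1 (le_lt_trans uE) // mulrA [u * Q]mulrC.
by rewrite ltr_pM2r.
Qed.

(* The bound is |q' alpha - p'| > q'^(-1-4/N) with integral exponents. *)
Lemma approximation_lower_bound (R : realType) (b : nat) (alpha : R) (N : nat) :
  (2 <= b)%N -> (0 < N)%N -> (forall n, well_approximated b alpha n) ->
  exists M : nat, forall (p' : int) (q' : nat), (M <= q')%N ->
    1 < `|q'%:R * alpha - p'%:~R| ^+ N * q'%:R ^+ N.+4.
Proof.
move=> b2 N0 wa.
have [C [c [m0 [C0 c0 wN]]]] := well_approximated_uniform N.*2.+1 b2 wa.
(* [D1] and [D2] are the constants lost when [p'/q'] differs from [p/q] and when it agrees; [D3]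
   forces the minimal [m] below to exceed [m0]. *)
pose D1 := 2 ^+ N * (C ^+ N * (2 * C) ^+ N.+2).
pose D2 := C ^+ N * (2 * C) ^+ (N + N).+3 / c ^+ N.
pose D3 := (b%:R ^+ (2 ^ m0)) ^+ (N + N) / (2 * C).
have C20 : 0 < 2 * C by rewrite mulr_gt0.
have bR : 2 <= b%:R :> R by rewrite ler_nat.
have b0 : 0 < b%:R :> R by lra.
have D10 : 0 < D1.
  exact: mulr_gt0 (exprn_gt0 _ _) (mulr_gt0 (exprn_gt0 _ C0) (exprn_gt0 _ C20)).
have D20 : 0 < D2.
  exact: divr_gt0 (mulr_gt0 (exprn_gt0 _ C0) (exprn_gt0 _ C20)) (exprn_gt0 _ c0).
have D30 : 0 < D3 := divr_gt0 (exprn_gt0 _ (exprn_gt0 _ b0)) C20.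
have DD0 : 0 <= D1 + D2 + D3 + 1 by rewrite !addr_ge0 // ltW.
exists (Num.bound (D1 + D2 + D3 + 1)) => p' q' Mq.
set Q : R := q'%:R; set w := `|_|.
have DQ : D1 + D2 + D3 + 1 < Q.
  by rewrite (lt_le_trans (archi_boundP DD0)) // ler_nat.
have Q1 : 1 < Q by lra.
have D1Q : D1 < Q by lra.
have D2Q : D2 < Q by lra.
have D3Q : D3 < Q by lra.
have Q0 : 0 < Q by lra.
have w0 : 0 <= w by exact: normr_ge0.
(* Once [X^(n+1) > K], the bound [d <= C / X^(n+1)] gives [Q d <= 1/2]. *)
pose K := 2 * C * Q; have K0 : 0 < K by rewrite mulr_gt0.
have X1 m : 1 < b%:R ^+ (2 ^ m) :> R.
  rewrite (@lt_le_trans _ _ b%:R) //; first by move: bR; clear; lra.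
  by rewrite -[leLHS]expr1 ler_weXn2l ?expn_gt0 //; move: bR; clear; lra.
(* The least such [m] works: [X] at [m] is the square of [X] at [m - 1], so failure of the strict
   bound at [m - 1] is exactly [X^N <= K] at [m]. Thus a factor [X] costs only [K^(1/N)]. *)
have [m [mm0 KXm XNK]] : exists m, [/\ (m0 <= m)%N,
    K < (b%:R ^+ (2 ^ m)) ^+ (N + N) & (b%:R ^+ (2 ^ m)) ^+ N <= K].
  pose P m := (m0 <= m)%N && (K < (b%:R ^+ (2 ^ m)) ^+ (N + N)).
  have [m1 hm1] := pow2_pow_unbounded K b2.
  have exP : exists m, P m.
    exists (maxn m0 m1); rewrite /P leq_maxl /=.
    apply: lt_le_trans (hm1 _ (leq_maxr m0 m1)) _.
    by rewrite -[leLHS]expr1 ler_weXn2l ?(ltW (X1 _)) ?addn_gt0 ?N0.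
  case: (ex_minnP exP) => m /andP[mm0 Km] min; exists m; split=> //.
  have mne : m != m0.
    apply/eqP => E; move: Km D3Q; rewrite E /D3 ltr_pdivrMr // [Q * _]mulrC.
    by move=> /lt_trans h /h; rewrite ltxx.
  case: m mm0 Km min mne => [|m] mm0 Km min mne.
    by move: mm0 mne; rewrite leqn0 => /eqP ->.
  rewrite expnSr exprM -exprM mul2n -addnn leNgt; apply/negP => Kt.
  have := min m; rewrite /P Kt andbT ltnn => nm.
  suff /nm : (m0 <= m)%N by [].
  by move: mm0; rewrite leq_eqVlt [m0 == _]eq_sym (negPf mne) /= ltnS => ->.
have X1m := X1 m; have wNm := wN^~ m; clear X1 wN.
set X : R := b%:R ^+ (2 ^ m) in KXm XNK X1m.
have X0 : 0 < X by exact: lt_trans ltr01 X1m.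
have [n [nN KXn XnK]] : exists n, [/\ (n < N + N)%N, K < X ^+ n.+1 & X ^+ n <= K].
  have exP : exists n, K < X ^+ n by exists (N + N)%N.
  case: (ex_minnP exP) => -[|n] Kn min.
    have K1 : 1 <= K := le_trans (exprn_ege1 N (ltW X1m)) XNK.
    by have := lt_le_trans Kn K1; rewrite ltxx.
  exists n; split=> //; first exact: min.
  by rewrite leNgt; apply/negP => /min; rewrite ltnn.
have [|p [q [qC /andP[cX XC]]]] := wNm n.+1 _ mm0; first by rewrite ltnS -addnn.
rewrite -/X in qC cX XC; set d := `|_| in cX XC.
have d0 : 0 <= d by exact: normr_ge0.
have XnX : X ^+ n.+2 <= K * X ^+ 2.
  by rewrite -addn2 exprD ler_wpM2r // exprn_ge0 // ltW.
have qK : `|q%:~R| * w <= C * K * X ^+ 2 * w.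
  by rewrite ler_wpM2r // (le_trans qC) // -mulrA ler_wpM2l // ltW.
have X2N : (X ^+ 2) ^+ N <= K ^+ 2.
  by rewrite -exprM mulnC exprM lerXn2r ?nnegrE ?exprn_ge0 ?(ltW X0) ?(ltW K0).
have X3N : (X ^+ 3) ^+ N <= K ^+ 3.
  by rewrite -exprM mulnC exprM lerXn2r ?nnegrE ?exprn_ge0 ?(ltW X0) ?(ltW K0).
have wN0 : 0 <= w ^+ N by rewrite exprn_ge0.
(* If the cross products agree, [Q d = |q| w] and the lower bound on [d] passes to [w]. Otherwise
   the nonzero integer [q' p - q p'] gives [1 <= Q d + |q| w], where [Q d <= 1/2]. *)
have [E|NE] := eqVneq (q * p') (Posz q' * p).
- have Qd : Q * d = `|q%:~R| * w.
    rewrite /d /w -[Q in LHS]ger0_norm ?(ltW Q0) // -!normrM; congr `|_|.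
    rewrite !mulrBr -[q%:~R * p'%:~R]rmorphM /= E rmorphM /=; ring.
  have h : Q * c <= C * K ^+ 2 * X ^+ 3 * w.
    rewrite (le_trans (ler_wpM2l (ltW Q0) cX)) // mulrCA Qd.
    rewrite (le_trans (ler_wpM2l (exprn_ge0 _ (ltW X0)) qK)) //.
    have -> : C * K ^+ 2 * X ^+ 3 * w = (K * X) * (C * K * X ^+ 2 * w) by ring.
    have r0 : 0 <= C * K * X ^+ 2 * w.
      exact: mulr_ge0 (mulr_ge0 (mulr_ge0 (ltW C0) (ltW K0)) (exprn_ge0 _ (ltW X0))) w0.
    by rewrite ler_wpM2r // exprSr ler_wpM2r // ltW.
  have hN : Q ^+ N * c ^+ N <= C ^+ N * (2 * C) ^+ (N + N).+3 * (Q ^+ (N + N).+3 * w ^+ N).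
    have -> : C ^+ N * (2 * C) ^+ (N + N).+3 * (Q ^+ (N + N).+3 * w ^+ N)
            = C ^+ N * (K ^+ 2) ^+ N * K ^+ 3 * w ^+ N.
      have KK : (K ^+ 2) ^+ N * K ^+ 3 = (2 * C) ^+ (N + N).+3 * Q ^+ (N + N).+3.
        by rewrite -exprM -exprD -exprMn mul2n addnn addn3.
      by rewrite -[C ^+ N * _ * K ^+ 3]mulrA KK !mulrA.
    rewrite -exprMn.
    apply: (@le_trans _ _ ((C * K ^+ 2 * X ^+ 3 * w) ^+ N)).
      have Qc : 0 <= Q * c := mulr_ge0 (ltW Q0) (ltW c0).
      by rewrite lerXn2r ?nnegrE ?(le_trans Qc h).
    rewrite 3!exprMn; apply: ler_wpM2r => //; apply: ler_wpM2l X3N.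
    exact: mulr_ge0 (exprn_ge0 _ (ltW C0)) (exprn_ge0 _ (exprn_ge0 _ (ltW K0))).
  have QG : Q ^+ (N + N).+3 = Q ^+ N * Q ^+ N.+3.
    by rewrite -exprD !addnS.
  rewrite QG -[Q ^+ N * _ * _]mulrA mulrCA (ler_pM2l (exprn_gt0 N Q0)) in hN.
  rewrite mulrC [Q ^+ _]exprS -mulrA; apply: mulr_gt1_of_le hN _.
  - by rewrite exprn_gt0.
  - by rewrite mulr_ge0 // exprn_ge0 // ltW.
  - by rewrite -ltr_pdivrMr ?exprn_gt0.
- have Qd : 2 * (Q * d) <= 1.
    rewrite -(ler_pM2l (exprn_gt0 n.+1 X0)) mulr1 (le_trans _ (ltW KXn)) //.
    have -> : X ^+ n.+1 * (2 * (Q * d)) = 2 * Q * (X ^+ n.+1 * d) by ring.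
    by rewrite /K [2 * C * Q]mulrAC ler_wpM2l // mulr_ge0 // ltW.
  have E1 : 1 <= Q * d + `|q%:~R| * w.
    have -> : Q * d = `|Q * (q%:~R * alpha - p%:~R)| by rewrite normrM (ger0_norm (ltW Q0)).
    rewrite -normrM addrC (le_trans _ (ler_normB _ _)) //.
    have -> : q%:~R * (Q * alpha - p'%:~R) - Q * (q%:~R * alpha - p%:~R)
            = (Posz q' * p - q * p')%:~R.
      by rewrite rmorphB !rmorphM /=; ring.
    by rewrite -intr_norm -[1]/(1%:~R) ler_int -gtz0_ge1 normr_gt0 subr_eq0 eq_sym.
  have h : 1 <= 2 * (C * K * X ^+ 2 * w) by move: Qd E1 qK; clear; lra.
  have hN : 1 <= D1 * (Q ^+ N.+2 * w ^+ N).
    have -> : D1 * (Q ^+ N.+2 * w ^+ N)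
            = 2 ^+ N * (C ^+ N * K ^+ N * K ^+ 2 * w ^+ N).
      have KK : K ^+ N * K ^+ 2 = (2 * C) ^+ N.+2 * Q ^+ N.+2.
        by rewrite -exprD -exprMn addn2.
      by rewrite /D1 -[C ^+ N * _ * K ^+ 2]mulrA KK !mulrA.
    apply: (@le_trans _ _ ((2 * (C * K * X ^+ 2 * w)) ^+ N)).
      by rewrite exprn_ege1.
    rewrite 4!exprMn; apply: ler_wpM2l; first exact: exprn_ge0.
    apply: ler_wpM2r => //; apply: ler_wpM2l X2N.
    exact: mulr_ge0 (exprn_ge0 _ (ltW C0)) (exprn_ge0 _ (ltW K0)).
  have : 1 < Q * (Q ^+ N.+2 * w ^+ N).
    by apply: mulr_gt1_of_le hN _; rewrite ?mulr1 // mulr_ge0 // exprn_ge0 // ltW.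
  rewrite mulrA -exprS [_ ^+ N * _]mulrC => /lt_le_trans; apply.
  by rewrite ler_wpM2r // ler_weXn2l // ltW.
Qed.

(** * Computing the irrationality exponent *)

(** Used for infinitude: finitely many solutions would bound their nonzero linear forms below,
    against arbitrarily small ones. *)
Lemma finite_set_min_pos (R : realDomainType) (T : eqType) (f : T -> R) (A : set T) :
  finite_set A -> exists2 d, 0 < d & forall x, A x -> 0 < f x -> d <= f x.
Proof.
move=> /finite_seqP[s ->]; elim: s => [|x s [d d0 ds]]; first by exists 1.
case: (ltP 0 (f x)) => [fx0|fx0].
  exists (Num.min d (f x)) => [|y]; first by rewrite lt_min d0.
  rewrite /= inE => /predU1P[->|ys] fy; first by rewrite ge_min lexx orbT.
  by rewrite ge_min ds.
exists d => // y; rewrite /= inE => /predU1P[->|ys] fy; last exact: ds.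
by move: (lt_le_trans fy fx0); rewrite ltxx.
Qed.

Lemma finite_set_int_nat_box (L M : nat) :
  finite_set [set pq : int * nat | (`|pq.1| <= L)%N /\ (pq.2 < M)%N].
Proof.
have fI (k : nat) : finite_set [set i : nat | (i < k)%N] by exact: finite_II.
pose s := [set i : nat | (i < L.+1)%N].
apply: (@sub_finite_set _ _ (((Posz @` s) `|` ((fun i : nat => - Posz i) @` s))
   `*` [set i : nat | (i < M)%N])).
  move=> [p q] /= [pL qM]; split=> //=.
  have [p0|p0] := leP 0 p; [left|right]; exists (absz p) => //=.
    by rewrite gez0_abs.
  by rewrite ltz0_abs // opprK.
apply: finite_setX; last exact: fI.
by rewrite finite_setU; split; apply: finite_image; exact: fI.
Qed.

Lemma natr_approx_error (R : numFieldType) (alpha : R) (p : int) (q : nat) : (0 < q)%N ->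
  `|alpha - p%:~R / q%:R| = `|q%:R * alpha - p%:~R| / q%:R.
Proof.
move=> q0; have q0R : q%:R != 0 :> R by rewrite pnatr_eq0 -lt0n.
have qV : `|q%:R^-1| = q%:R^-1 :> R by rewrite ger0_norm ?invr_ge0.
rewrite -[X in _ = _ * X]qV -normrM mulrBl; congr (`|_ - _|).
by rewrite mulrAC divff // mul1r.
Qed.

Lemma irrationality_exponent_eq2 (R : realType) (b : nat) (alpha : R) :
  (2 <= b)%N -> (forall n, well_approximated b alpha n) ->
  irrationality_exponent alpha = 2%:E.
Proof.
move=> b2 wa; apply/eqP; rewrite eq_le; apply/andP; split.
  apply: ge_ereal_sup => _ [mu infA <-]; rewrite lee_fin leNgt; apply/negP => mu2.
  (* A solution with [q >= M] would make the product in [approximation_lower_bound] at most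
     [q^(4 - N(mu - 2))], which is at most 1 for this [N]. *)
  pose N := Num.bound (4 / (mu - 2)).
  have e0 : 0 < mu - 2 by lra.
  have hN : 4 < N%:R * (mu - 2).
    by rewrite -ltr_pdivrMr // archi_boundP // divr_ge0 // ltW.
  have N0 : (0 < N)%N.
    by rewrite lt0n; apply/eqP => N0; move: hN; rewrite N0 mul0r ltNge ler0n.
  have [M hM] := approximation_lower_bound b2 N0 wa.
  (* Solutions have [q < M] and [|q alpha - p| <= q], hence [|p| <= M (|alpha| + 1)]. *)
  apply: infA; pose L := Num.bound (M%:R * (`|alpha| + 1)).
  apply: sub_finite_set (finite_set_int_nat_box L M) => -[p q] /= [q0].
  rewrite natr_approx_error // => ineq.
  have q1 : 1 <= q%:R :> R by rewrite ler1n.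
  have qR : 0 < q%:R :> R by lra.
  have qM : (q < M)%N.
    rewrite ltnNge; apply/negP => Mq; have := hM p q Mq; rewrite ltNge => /negP[].
    move: ineq; rewrite ltr_pdivrMr //; set w := `|_| => ineq.
    apply: (@le_trans _ _ ((q%:R `^ (- mu) * q%:R) ^+ N * q%:R ^+ N.+4)).
      rewrite ler_wpM2r ?exprn_ge0 ?(ltW qR) //.
      have z0 : 0 <= q%:R `^ (- mu) * q%:R := mulr_ge0 (powR_ge0 _ _) (ltW qR).
      by rewrite lerXn2r ?nnegrE ?normr_ge0 ?(ltW ineq).
    have qn0 : q%:R != 0 :> R by rewrite gt_eqF.
    rewrite -{2}(powRr1 (ltW qR)) -powRD ?qn0 ?implybT //.
    rewrite -!powR_mulrn ?powR_ge0 ?(ltW qR) // -powRrM -powRD ?qn0 ?implybT //.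
    rewrite -[leRHS](powRr0 q%:R) ler_powR //.
    rewrite -addn4 natrD; move: hN; clear; lra.
  split=> //; rewrite -(ler_nat R) natr_absz intr_norm.
  have w1 : `|q%:R * alpha - p%:~R| <= q%:R.
    move: ineq; rewrite ltr_pdivrMr // => /ltW /le_trans; apply.
    rewrite ler_piMl ?(ltW qR) // -[leRHS](powRr0 q%:R) ler_powR //.
    by move: mu2; clear; lra.
  have L0 : 0 <= M%:R * (`|alpha| + 1) by rewrite mulr_ge0 ?addr_ge0.
  rewrite (le_trans _ (ltW (archi_boundP L0))) //.
  have -> : p%:~R = q%:R * alpha - (q%:R * alpha - p%:~R) by rewrite opprB addrC subrK.
  rewrite (le_trans (ler_normB _ _)) // (le_trans (lerD (lexx _) w1)) //.
  rewrite normrM normr_nat -{2}[q%:R]mulr1 -mulrDr ler_wpM2r ?addr_ge0 //.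
  by rewrite ler_nat ltnW.
(* It suffices that every [2 - e] is attained; membership of 2 itself is left open. *)
apply/lee_subgt0Pr => e e0; apply: ereal_sup_ubound.
exists (2 - e) => //= finA.
pose A := [set pq : int * nat | (0 < pq.2)%N /\
   `|alpha - pq.1%:~R / pq.2%:R| < pq.2%:R `^ (- (2 - e))].
have [d d0 dA] := @finite_set_min_pos R _ (fun pq : int * nat => `|pq.2%:R * alpha - pq.1%:~R|) A finA.
(* A failure of the inequality for [2 - e] would give [w^(k+2) q^k >= q^(e(k+2) - 2) >= 1], since
   [k e >= 2]. *)
pose k := Num.bound (2 / e).
have [p [q [q0 /andP[w0 wd] wk]]] := exists_good_approximation b2 (wa k.+1) d0.
suff /dA : A (p, q) by move=> /(_ w0); rewrite /= leNgt wd.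
split=> //=.
have q1 : 1 <= q%:R :> R by rewrite ler1n.
have qR : 0 < q%:R :> R by lra.
have qn0 : q%:R != 0 :> R by rewrite gt_eqF.
rewrite natr_approx_error // ltr_pdivrMr // ltNge; apply/negP => le.
move: wk; rewrite ltNge => /negP[]; rewrite -{2}(powRr1 (ltW qR)) in le.
rewrite -powRD ?qn0 ?implybT // in le.
apply: (@le_trans _ _ ((q%:R `^ (- (2 - e) + 1)) ^+ k.+2 * q%:R ^+ k)); last first.
  by rewrite ler_wpM2r ?exprn_ge0 ?(ltW qR) // lerXn2r ?nnegrE ?powR_ge0.
rewrite -!powR_mulrn ?powR_ge0 ?(ltW qR) // -powRrM -powRD ?qn0 ?implybT //.
rewrite -[leLHS](powRr0 q%:R) ler_powR // -addn2 natrD.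
have : 2 <= k%:R * e by rewrite -ler_pdivrMr // ltW // archi_boundP // divr_ge0 // ltW.
by move: e0; clear; lra.
Qed.

(** * Convergence of the series and conclusion *)

(** The terms are nonnegative and at most [2 / b^(2^k)]. With [B = b^(2^K) >= 2], the tail bound
    propagates by [2/B + 4/B^2 <= 4/B]; the partial sums are thus increasing and bounded. *)
Lemma lambert_value_limn (R : realType) (b : nat) (e : int) :
  (2 <= b)%N -> e ^+ 2 = 1 ->
  lambert_value b e (limn (series (fun k => (b%:R ^+ (2 ^ k) - e%:~R)^-1 : R))).
Proof.
move=> b2 e2; set u : nat -> R := fun k => _; set s := series u.
have bR : 2 <= b%:R :> R by rewrite ler_nat.
have B2 k : 2 <= b%:R ^+ (2 ^ k) :> R.
  by rewrite (le_trans bR) // -[leLHS]expr1 ler_weXn2l ?expn_gt0 //; lra.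
have E1 : e%:~R <= 1 :> R.
  have : e%:~R ^+ 2 = 1 :> R by rewrite -rmorphXn e2.
  by move=> /eqP; rewrite sqrf_eq1 => /orP[] /eqP ->; lra.
have Be k : 0 < b%:R ^+ (2 ^ k) - e%:~R :> R by have := B2 k; lra.
have u0 k : 0 <= u k by rewrite invr_ge0 ltW.
have u2 k : u k <= 2 / b%:R ^+ (2 ^ k).
  have Bk := B2 k; have B0 : 0 < b%:R ^+ (2 ^ k) :> R by lra.
  by rewrite /u -[leLHS]mul1r ler_pdivrMr // mulrAC ler_pdivlMr //; lra.
have tail j K : \sum_(k < j) u (K + k)%N <= 4 / b%:R ^+ (2 ^ K).
  elim: j K => [|j IH] K.
    by rewrite big_ord0 divr_ge0 // (le_trans _ (B2 K)).
  rewrite big_ord_recl addn0.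
  under eq_bigr do rewrite /= addnS -addSn.
  rewrite (le_trans (lerD (u2 K) (IH K.+1))) // expnSr exprM.
  have := B2 K; set B : R := b%:R ^+ _ => Bge.
  have B0 : 0 < B by lra.
  have B1 : B^-1 <= 2^-1 by rewrite lef_pV2 ?posrE //; lra.
  have V0 : 0 < B^-1 by rewrite invr_gt0.
  rewrite expr2 invfM; have : B^-1 * B^-1 <= 2^-1 * B^-1 by rewrite ler_wpM2r // ltW.
  lra.
have sE n : s n = \sum_(k < n) u k by rewrite /s /series /= big_mkord.
have snd : {homo s : n m / (n <= m)%N >-> n <= m}.
  by apply/nondecreasing_seqP => n; rewrite !sE big_ord_recr lerDl.
have sle K n : s n <= \sum_(k < K) u k + 4 / b%:R ^+ (2 ^ K).
  rewrite (le_trans (snd _ _ (leq_addl K n))) // sE big_split_ord /= lerD2l.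
  exact: tail.
have cs : cvgn s.
  apply: nondecreasing_is_cvgn => //.
  by eexists => _ [n _ <-]; exact: (sle 0%N).
move=> K; rewrite ger0_norm; first by rewrite lerBlDl; apply: limr_le => //; near=> n; exact: sle.
by rewrite subr_ge0 -sE; exact: nondecreasing_cvgn_le.
Unshelve. all: by end_near.
Qed.

Lemma irrationality_exponent_limn (R : realType) (b : nat) (e : int) (v : R^nat) :
  (2 <= b)%N -> e ^+ 2 = 1 -> (forall k, v k = (b%:R ^+ (2 ^ k) - e%:~R)^-1) ->
  irrationality_exponent (limn (series v)) = 2%:E.
Proof.
move=> b2 e2 /funext ->; apply: (irrationality_exponent_eq2 b2) => n.
exact: lambert_well_approximated b2 e2 (lambert_value_limn R b2 e2).
Qed.

Theorem theorem1p1 (R : realType) :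
  (forall b : nat, (2 <= b)%N ->
     irrationality_exponent (calG (b%:R^-1 : R)) = 2%:E /\
     irrationality_exponent (calF (b%:R^-1 : R)) = 2%:E) /\
  irrationality_exponent
    (limn (series (fun n => 1 / (2 ^+ (2 ^ n) + 1) : R))) = 2%:E.
Proof.
have termE (b k : nat) (e : R) : (2 <= b)%N ->
    b%:R^-1 ^+ (2 ^ k) / (1 - e * b%:R^-1 ^+ (2 ^ k)) = (b%:R ^+ (2 ^ k) - e)^-1 :> R.
  move=> b2; rewrite exprVn; set B := _ ^+ _.
  have B0 : B != 0 by rewrite expf_neq0 // pnatr_eq0; case: b b2 @B.
  have -> : 1 - e * B^-1 = (B - e) / B by rewrite mulrBl divff.
  by rewrite invf_div mulrA mulVf // mul1r.
split=> [b b2|]; first split.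
- apply: (@irrationality_exponent_limn _ b 1) => // k.
  by rewrite -(termE b k _ b2) mul1r.
- apply: (@irrationality_exponent_limn _ b (- 1)) => // k.
  by rewrite -(termE b k _ b2) mulrN1z mulN1r opprK.
- apply: (@irrationality_exponent_limn _ 2 (- 1)) => // k.
  by rewrite mulrN1z opprK div1r.
Qed.
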